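(* Let $n\ge1$ and let $\sigma\in S_n$ be a permutation of $\{1,\ldots,n\}$. If $\sigma\ne\mathrm{id}$, then the cohomology group of the representation $\rho_\sigma$ of $\mathrm{Pol}(S_n^+)$ associated to $\sigma$ is $$\mathcal{H}_1(\rho_\sigma)\cong\mathbb{C}^{\mathrm{cyc}(\sigma)-\mathrm{fix}(\sigma)-1},$$ where $\mathrm{cyc}(\sigma)$ and $\mathrm{fix}(\sigma)$ denote the number of cycles and the number of fixed points of $\sigma$, respectively. For $\sigma=\mathrm{id}$ we have $\rho_{\mathrm{id}}=\varepsilon$ and $B_1(\varepsilon)\cong Z_1(\varepsilon)\cong\mathcal{H}_1(\varepsilon)\cong\{0\}$.
   Context: $\mathrm{Pol}(S_n^+)$ is the universal unital $*$-algebra generated by $p_{ij}$ ($1\le i,j\le n$) subject to $p_{ij}=p_{ij}^*=p_{ij}^2$, $p_{ij}p_{ik}=0=p_{ji}p_{ki}$ for $j\ne k$, and $\sum_j p_{ij}=\sum_j p_{ji}=1$ for all $i$; its counit $\varepsilon$ is the character with $\varepsilon(p_{ij})=\delta_{ij}$. For $\sigma\in S_n$, $\rho_\sigma$ is the one-dimensional representation of $\mathrm{Pol}(S_n^+)$ on $\mathbb{C}$ with $\rho_\sigma(p_{ij})=1$ if $\sigma(i)=j$ and $\rho_\sigma(p_{ij})=0$ otherwise. Cycles are counted in the full disjoint cycle decomposition, with each fixed point counted as a cycle of length one. For a representation (unital $*$-homomorphism) $\rho:\mathrm{Pol}(S_n^+)\to B(\mathsf{h})$, $Z_1(\rho)$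 is the vector space of all $\rho$-$\varepsilon$-cocycles, i.e. linear maps $\eta:\mathrm{Pol}(S_n^+)\to\mathsf{h}$ with $\eta(ab)=\rho(a)\eta(b)+\eta(a)\varepsilon(b)$; $B_1(\rho)$ is the subspace of 1-coboundaries, i.e. maps of the form $a\mapsto(\rho(a)-\varepsilon(a)\mathrm{id}_{\mathsf{h}})v$ with $v\in\mathsf{h}$; and $\mathcal{H}_1(\rho)=Z_1(\rho)/B_1(\rho)$. *)

(* Defs.v *)
From HB Require Import structures.
From mathcomp Require Import all_boot all_order all_algebra all_fingroup.
From mathcomp Require Import ring_quotient generic_quotient.
From mathcomp Require Import boolp functions reals.
From mathcomp Require Import complex.

Set Implicit Arguments.
Unset Strict Implicit.
Unset Printing Implicit Defensive.

Import Order.TTheory GRing.Theory Num.Theory.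
Local Open Scope ring_scope.
Local Open Scope quotient_scope.

HB.mixin Record hasStar (C : numClosedFieldType) A of GRing.Algebra C A := {
  star : A -> A;
  starK : involutive star;
  starD : {morph star : a b / a + b};
  starZ : forall (c : C) (a : A), star (c *: a) = c^* *: star a;
  starM : forall a b : A, star (a * b) = star b * star a
}.

#[short(type="starAlgType")]
HB.structure Definition StarAlgebra (C : numClosedFieldType) :=
  {A of GRing.Algebra C A & hasStar C A}.

HB.mixin Record isStarMorphism (C : numClosedFieldType) (A B : starAlgType C)
    (f : A -> B) := {
  starmorph_star : {morph f : a / star a >-> star a}
}.

#[short(type="starMorphism")]
HB.structure Definition StarMorphism (C : numClosedFieldType)
    (A B : starAlgType C) :=
  {f of isStarMorphism C A B f & @GRing.LRMorphism C A B *:%R f}.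

Section RegularStar.
Variable C : numClosedFieldType.

Let conj_starZ (c : C) (a : C^o) : (c *: a : C^o)^* = c^* *: (a^* : C^o).
Proof. by rewrite [LHS]rmorphM. Qed.

Let conj_starM (a b : C^o) : (a * b : C^o)^* = (b^* : C^o) * a^*.
Proof. by rewrite [LHS]rmorphM mulrC. Qed.

HB.instance Definition _ := hasStar.Build C C^o
  (@conjCK C) (fun a b : C^o => rmorphD (@Num.conj C) a b) conj_starZ conj_starM.

End RegularStar.

Definition magic_unitary (C : numClosedFieldType) (A : starAlgType C) (n : nat)
    (p : 'I_n -> 'I_n -> A) : Prop :=
  [/\ forall i j, p i j = star (p i j) /\ p i j = p i j ^+ 2,
      forall i j k, j != k -> p i j * p i k = 0,
      forall i j k, j != k -> p j i * p k i = 0,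
      forall i, \sum_j p i j = 1
    & forall i, \sum_j p j i = 1].

Section Pol.
Variables (C : numClosedFieldType) (n : nat).

Inductive term : Type :=
| TGen of 'I_n & 'I_n
| TZero
| TOne
| TOpp of term
| TAdd of term & term
| TMul of term & term
| TScale of C & term
| TStar of term.

HB.instance Definition _ := gen_eqMixin term.
HB.instance Definition _ := gen_choiceMixin term.

(* The least congruence on *-polynomial expressions in the generators that
   contains the axioms of unital *-algebras and the defining relations, so that
   [Pol] below is the universal *-algebra (see [Pol_universal]). *)
Inductive cong : term -> term -> Prop :=
| cong_refl t : cong t t
| cong_sym t u : cong t u -> cong u t
| cong_trans t u v : cong t u -> cong u v -> cong t v
| cong_opp t t' : cong t t' -> cong (TOpp t) (TOpp t')
| cong_add t t' u u' : cong t t' -> cong u u' -> cong (TAdd t u) (TAdd t' u')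
| cong_mul t t' u u' : cong t t' -> cong u u' -> cong (TMul t u) (TMul t' u')
| cong_scale c t t' : cong t t' -> cong (TScale c t) (TScale c t')
| cong_star t t' : cong t t' -> cong (TStar t) (TStar t')
| cong_addA t u v : cong (TAdd t (TAdd u v)) (TAdd (TAdd t u) v)
| cong_addC t u : cong (TAdd t u) (TAdd u t)
| cong_add0 t : cong (TAdd TZero t) t
| cong_addN t : cong (TAdd (TOpp t) t) TZero
| cong_mulA t u v : cong (TMul t (TMul u v)) (TMul (TMul t u) v)
| cong_mul1l t : cong (TMul TOne t) t
| cong_mul1r t : cong (TMul t TOne) t
| cong_mulDl t u v : cong (TMul (TAdd t u) v) (TAdd (TMul t v) (TMul u v))
| cong_mulDr t u v : cong (TMul t (TAdd u v)) (TAdd (TMul t u) (TMul t v))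
| cong_scaleA c d t : cong (TScale c (TScale d t)) (TScale (c * d) t)
| cong_scale1 t : cong (TScale 1 t) t
| cong_scaleDr c t u : cong (TScale c (TAdd t u)) (TAdd (TScale c t) (TScale c u))
| cong_scaleDl c d t : cong (TScale (c + d) t) (TAdd (TScale c t) (TScale d t))
| cong_scaleMl c t u : cong (TScale c (TMul t u)) (TMul (TScale c t) u)
| cong_scaleMr c t u : cong (TScale c (TMul t u)) (TMul t (TScale c u))
| cong_starK t : cong (TStar (TStar t)) t
| cong_starD t u : cong (TStar (TAdd t u)) (TAdd (TStar t) (TStar u))
| cong_starZ c t : cong (TStar (TScale c t)) (TScale c^* (TStar t))
| cong_starM t u : cong (TStar (TMul t u)) (TMul (TStar u) (TStar t))
| cong_gen_star i j : cong (TGen i j) (TStar (TGen i j))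
| cong_gen_idem i j : cong (TGen i j) (TMul (TGen i j) (TGen i j))
| cong_gen_row i j k : j != k -> cong (TMul (TGen i j) (TGen i k)) TZero
| cong_gen_col i j k : j != k -> cong (TMul (TGen j i) (TGen k i)) TZero
| cong_sum_row i : cong (\big[TAdd/TZero]_(j < n) TGen i j) TOne
| cong_sum_col i : cong (\big[TAdd/TZero]_(j < n) TGen j i) TOne.

Definition congb (t u : term) : bool := `[< cong t u >].

Lemma congb_equiv : equiv_class_of congb.
Proof.
split=> [t|t u|u t v].
- by apply/asboolP; apply: cong_refl.
- by apply/asboolP/asboolP; apply: cong_sym.
- by move=> /asboolP tu /asboolP uv; apply/asboolP; apply: cong_trans tu uv.
Qed.

Canonical congb_equivRel := EquivRelPack congb_equiv.
Canonical congb_encModRel := defaultEncModRel congb.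

Definition Pol := {eq_quot congb}.

HB.instance Definition _ : EqQuotient term congb Pol := EqQuotient.on Pol.
HB.instance Definition _ := Choice.on Pol.

Lemma Pol_eqP t u : \pi_Pol t = \pi_Pol u <-> cong t u.
Proof.
split=> [/eqP|tu]; first by rewrite piE => /asboolP.
by apply/eqP; rewrite piE; apply/asboolP.
Qed.

Lemma repr_cong t : cong (repr (\pi_Pol t)) t.
Proof. by apply/Pol_eqP; rewrite reprK. Qed.

Definition Pol_zero : Pol := \pi_Pol TZero.
Definition Pol_one : Pol := \pi_Pol TOne.
Definition Pol_opp (a : Pol) : Pol := \pi_Pol (TOpp (repr a)).
Definition Pol_add (a b : Pol) : Pol := \pi_Pol (TAdd (repr a) (repr b)).
Definition Pol_mul (a b : Pol) : Pol := \pi_Pol (TMul (repr a) (repr b)).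
Definition Pol_scale (c : C) (a : Pol) : Pol := \pi_Pol (TScale c (repr a)).
Definition Pol_star (a : Pol) : Pol := \pi_Pol (TStar (repr a)).

Lemma Pol_oppE t : Pol_opp (\pi_Pol t) = \pi_Pol (TOpp t).
Proof. by apply/Pol_eqP/cong_opp/repr_cong. Qed.
Lemma Pol_addE t u : Pol_add (\pi_Pol t) (\pi_Pol u) = \pi_Pol (TAdd t u).
Proof. by apply/Pol_eqP/cong_add; apply: repr_cong. Qed.
Lemma Pol_mulE t u : Pol_mul (\pi_Pol t) (\pi_Pol u) = \pi_Pol (TMul t u).
Proof. by apply/Pol_eqP/cong_mul; apply: repr_cong. Qed.
Lemma Pol_scaleE c t : Pol_scale c (\pi_Pol t) = \pi_Pol (TScale c t).
Proof. by apply/Pol_eqP/cong_scale/repr_cong. Qed.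
Lemma Pol_starE t : Pol_star (\pi_Pol t) = \pi_Pol (TStar t).
Proof. by apply/Pol_eqP/cong_star/repr_cong. Qed.

Lemma Pol_addA : associative Pol_add.
Proof.
by elim/quotW=> t; elim/quotW=> u; elim/quotW=> v; rewrite (Pol_addE u) (Pol_addE t u) !Pol_addE;
  apply/Pol_eqP; constructor.
Qed.
Lemma Pol_addC : commutative Pol_add.
Proof.
by elim/quotW=> t; elim/quotW=> u; rewrite !Pol_addE; apply/Pol_eqP; constructor.
Qed.
Lemma Pol_add0 : left_id Pol_zero Pol_add.
Proof. by elim/quotW=> t; rewrite Pol_addE; apply/Pol_eqP; constructor. Qed.
Lemma Pol_addN : left_inverse Pol_zero Pol_opp Pol_add.
Proof.
by elim/quotW=> t; rewrite Pol_oppE (Pol_addE _ t); apply/Pol_eqP; constructor.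
Qed.

HB.instance Definition _ :=
  GRing.isZmodule.Build Pol Pol_addA Pol_addC Pol_add0 Pol_addN.

Lemma Pol_mulA : associative Pol_mul.
Proof.
by elim/quotW=> t; elim/quotW=> u; elim/quotW=> v; rewrite (Pol_mulE u) (Pol_mulE t u) !Pol_mulE;
  apply/Pol_eqP; constructor.
Qed.
Lemma Pol_mul1l : left_id Pol_one Pol_mul.
Proof. by elim/quotW=> t; rewrite Pol_mulE; apply/Pol_eqP; constructor. Qed.
Lemma Pol_mul1r : right_id Pol_one Pol_mul.
Proof. by elim/quotW=> t; rewrite Pol_mulE; apply/Pol_eqP; constructor. Qed.
Lemma Pol_mulDl : left_distributive Pol_mul Pol_add.
Proof.
by elim/quotW=> t; elim/quotW=> u; elim/quotW=> v;
  rewrite (Pol_addE t) !Pol_mulE Pol_addE; apply/Pol_eqP; constructor.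
Qed.
Lemma Pol_mulDr : right_distributive Pol_mul Pol_add.
Proof.
by elim/quotW=> t; elim/quotW=> u; elim/quotW=> v;
  rewrite (Pol_addE u) !Pol_mulE Pol_addE; apply/Pol_eqP; constructor.
Qed.

Fixpoint eval (B : starAlgType C) (q : 'I_n -> 'I_n -> B) (t : term) : B :=
  match t with
  | TGen i j => q i j
  | TZero => 0
  | TOne => 1
  | TOpp t => - eval q t
  | TAdd t u => eval q t + eval q u
  | TMul t u => eval q t * eval q u
  | TScale c t => c *: eval q t
  | TStar t => star (eval q t)
  end.

Lemma eval_sum (B : starAlgType C) (q : 'I_n -> 'I_n -> B) (F : 'I_n -> term) :
  eval q (\big[TAdd/TZero]_(j < n) F j) = \sum_(j < n) eval q (F j).
Proof. by elim/big_ind2 : _ => // t a u b /= -> ->. Qed.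

Lemma eval_cong (B : starAlgType C) (q : 'I_n -> 'I_n -> B) :
  magic_unitary q -> forall t u, cong t u -> eval q t = eval q u.
Proof.
case=> q_proj q_row q_col q_sumr q_sumc t u; elim=> {t u} /=.
all: try by [].
all: try by move=> *; congruence.
- by move=> t u v; rewrite addrA.
- by move=> t u; rewrite addrC.
- by move=> t; rewrite add0r.
- by move=> t; rewrite addNr.
- by move=> t u v; rewrite mulrA.
- by move=> t; rewrite mul1r.
- by move=> t; rewrite mulr1.
- by move=> t u v; rewrite mulrDl.
- by move=> t u v; rewrite mulrDr.
- by move=> c d t; rewrite scalerA.
- by move=> t; rewrite scale1r.
- by move=> c t u; rewrite scalerDr.
- by move=> c d t; rewrite scalerDl.
- by move=> c t u; rewrite scalerAl.
- by move=> c t u; rewrite scalerAr.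
- by move=> t; rewrite starK.
- by move=> t u; rewrite starD.
- by move=> c t; rewrite starZ.
- by move=> t u; rewrite starM.
- by move=> i j; case: (q_proj i j).
- by move=> i j; rewrite -expr2; case: (q_proj i j).
- by move=> i; rewrite eval_sum /=.
- by move=> i; rewrite eval_sum /=.
Qed.

End Pol.

Section PermMatrix.
Variables (C : numClosedFieldType) (n : nat).

(* Row i has its 1 in column sigma(i), so [perm_mat 1] is the identity matrix. *)
Definition perm_mat (s : 'S_n) (i j : 'I_n) : C^o := (s i == j)%:R.

Lemma perm_mat_magic (s : 'S_n) : magic_unitary (perm_mat s).
Proof.
rewrite /perm_mat; split=> [i j|i j k jk|i j k jk|i|i].
- split; last by case: eqP => _; rewrite ?expr1n ?expr0n.
  by rewrite [RHS](rmorph_nat (@Num.conj C)).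
- case: eqP => [->|_]; last by rewrite mul0r.
  by rewrite (negPf jk) mulr0.
- case: eqP => [<-|_]; last by rewrite mul0r.
  by rewrite (inj_eq perm_inj) eq_sym (negPf jk) mulr0.
- rewrite (bigD1 (s i)) //= eqxx big1 ?addr0 // => j.
  by rewrite eq_sym => /negPf ->.
- rewrite (bigD1 ((s^-1)%g i)) //= permKV eqxx big1 ?addr0 // => j js.
  by rewrite -(inj_eq (@perm_inj _ (s^-1)%g)) permK (negPf js).
Qed.

End PermMatrix.

Section PolAlgebra.
Variables (C : numClosedFieldType) (n : nat).
Local Notation Pol := (Pol C n).

Lemma Pol_oner_neq0 : Pol_one C n != 0 :> Pol.
Proof.
apply/eqP => /Pol_eqP /(eval_cong (perm_mat_magic C 1%g))/eqP.
by rewrite /= oner_eq0.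
Qed.

HB.instance Definition _ := GRing.Zmodule_isNzRing.Build Pol
  (@Pol_mulA C n) (@Pol_mul1l C n) (@Pol_mul1r C n)
  (@Pol_mulDl C n) (@Pol_mulDr C n) Pol_oner_neq0.

Lemma Pol_scaleA c d (a : Pol) :
  Pol_scale c (Pol_scale d a) = Pol_scale (c * d) a.
Proof.
by elim/quotW: a => t; rewrite (Pol_scaleE d t) !Pol_scaleE; apply/Pol_eqP; constructor.
Qed.
Lemma Pol_scale1 : left_id 1 (@Pol_scale C n).
Proof. by elim/quotW=> t; rewrite Pol_scaleE; apply/Pol_eqP; constructor. Qed.
Lemma Pol_scaleDr : right_distributive (@Pol_scale C n) +%R.
Proof.
move=> c; elim/quotW=> t; elim/quotW=> u; rewrite [X in Pol_scale c X]Pol_addE.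
rewrite (Pol_scaleE c t) (Pol_scaleE c u) [RHS]Pol_addE Pol_scaleE.
by apply/Pol_eqP; constructor.
Qed.
Lemma Pol_scaleDl (a : Pol) : {morph (@Pol_scale C n)^~ a : c d / c + d}.
Proof.
elim/quotW: a => t c d /=.
rewrite (Pol_scaleE c t) (Pol_scaleE d t) Pol_scaleE [RHS]Pol_addE.
by apply/Pol_eqP; constructor.
Qed.

HB.instance Definition _ := GRing.Zmodule_isLmodule.Build C Pol
  Pol_scaleA Pol_scale1 Pol_scaleDr Pol_scaleDl.

Lemma Pol_scaleAl (c : C) (a b : Pol) : c *: (a * b) = (c *: a) * b.
Proof.
elim/quotW: a => t; elim/quotW: b => u.
rewrite [X in c *: X]Pol_mulE [LHS]Pol_scaleE [c *: \pi_Pol _]Pol_scaleE [RHS]Pol_mulE.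
by apply/Pol_eqP; constructor.
Qed.
Lemma Pol_scaleAr (c : C) (a b : Pol) : c *: (a * b) = a * (c *: b).
Proof.
elim/quotW: a => t; elim/quotW: b => u.
rewrite [X in c *: X]Pol_mulE [LHS]Pol_scaleE [c *: \pi_Pol _]Pol_scaleE [RHS]Pol_mulE.
by apply/Pol_eqP; constructor.
Qed.

HB.instance Definition _ :=
  GRing.Lmodule_isLalgebra.Build C Pol Pol_scaleAl.
HB.instance Definition _ := GRing.Lalgebra_isAlgebra.Build C Pol Pol_scaleAr.

Lemma Pol_starK : involutive (@Pol_star C n).
Proof. by elim/quotW=> t; rewrite (Pol_starE t) Pol_starE; apply/Pol_eqP; constructor. Qed.
Lemma Pol_starD : {morph @Pol_star C n : a b / a + b}.
Proof.
elim/quotW=> t; elim/quotW=> u.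
by rewrite [t' in Pol_star t']Pol_addE (Pol_starE t) (Pol_starE u) Pol_starE [RHS]Pol_addE; apply/Pol_eqP; constructor.
Qed.
Lemma Pol_starZ (c : C) (a : Pol) : Pol_star (c *: a) = c^* *: Pol_star a.
Proof.
elim/quotW: a => t.
by rewrite [t' in Pol_star t']Pol_scaleE (Pol_starE t) Pol_starE [RHS]Pol_scaleE; apply/Pol_eqP; constructor.
Qed.
Lemma Pol_starM (a b : Pol) : Pol_star (a * b) = Pol_star b * Pol_star a.
Proof.
elim/quotW: a => t; elim/quotW: b => u.
by rewrite [t' in Pol_star t']Pol_mulE (Pol_starE t) (Pol_starE u) Pol_starE [RHS]Pol_mulE; apply/Pol_eqP; constructor.
Qed.

HB.instance Definition _ :=
  hasStar.Build C Pol Pol_starK Pol_starD Pol_starZ Pol_starM.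

Definition Pol_gen (i j : 'I_n) : Pol := \pi_Pol (TGen C i j).

Lemma pi_Pol_eval t : \pi_Pol t = eval Pol_gen t.
Proof.
elim: t => //=.
- by move=> t <-; rewrite [RHS]Pol_oppE.
- by move=> t <- u <-; rewrite [RHS]Pol_addE.
- by move=> t <- u <-; rewrite [RHS]Pol_mulE.
- by move=> c t <-; rewrite [RHS]Pol_scaleE.
- by move=> t <-; rewrite [RHS]Pol_starE.
Qed.

Lemma Pol_gen_magic : magic_unitary Pol_gen.
Proof.
split.
- move=> i j; split.
    rewrite -[LHS]/(eval Pol_gen (TGen C i j)).
    rewrite -[RHS]/(eval Pol_gen (TStar (TGen C i j))) -!pi_Pol_eval.
    by apply/Pol_eqP; constructor.
  rewrite expr2 -[LHS]/(eval Pol_gen (TGen C i j)).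
  rewrite -[RHS]/(eval Pol_gen (TMul (TGen C i j) (TGen C i j))) -!pi_Pol_eval.
  by apply/Pol_eqP; constructor.
- move=> i j k jk.
  rewrite -[LHS]/(eval Pol_gen (TMul (TGen C i j) (TGen C i k))).
  by rewrite -[RHS]/(eval Pol_gen (TZero C n)) -!pi_Pol_eval; apply/Pol_eqP; constructor.
- move=> i j k jk.
  rewrite -[LHS]/(eval Pol_gen (TMul (TGen C j i) (TGen C k i))).
  by rewrite -[RHS]/(eval Pol_gen (TZero C n)) -!pi_Pol_eval; apply/Pol_eqP; constructor.
- move=> i; rewrite -[RHS]/(eval Pol_gen (TOne C n)).
  rewrite -(@eval_sum C n _ Pol_gen (fun j => TGen C i j)) -!pi_Pol_eval.
  by apply/Pol_eqP; constructor.
- move=> i; rewrite -[RHS]/(eval Pol_gen (TOne C n)).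
  rewrite -(@eval_sum C n _ Pol_gen (fun j => TGen C j i)) -!pi_Pol_eval.
  by apply/Pol_eqP; constructor.
Qed.

Section Universal.
Variables (B : starAlgType C) (q : 'I_n -> 'I_n -> B) (q_magic : magic_unitary q).

Definition Pol_lift of magic_unitary q := fun a : Pol => eval q (repr a).
Local Notation lift := (Pol_lift q_magic).

Lemma Pol_lift_pi t : lift (\pi_Pol t) = eval q t.
Proof. exact/(eval_cong q_magic)/repr_cong. Qed.

Lemma Pol_lift_gen i j : lift (Pol_gen i j) = q i j.
Proof. exact: Pol_lift_pi. Qed.

Lemma Pol_lift_zmod : zmod_morphism lift.
Proof.
elim/quotW=> t; elim/quotW=> u; rewrite [- _]Pol_oppE [_ + _]Pol_addE.
by rewrite !Pol_lift_pi.
Qed.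
Lemma Pol_lift_monoid : monoid_morphism lift.
Proof.
split; first exact: Pol_lift_pi.
by elim/quotW=> t; elim/quotW=> u; rewrite [_ * _]Pol_mulE !Pol_lift_pi.
Qed.
Lemma Pol_lift_scale : scalable lift.
Proof. by move=> c; elim/quotW=> t; rewrite [_ *: _]Pol_scaleE !Pol_lift_pi. Qed.
Lemma Pol_lift_star : {morph lift : a / star a >-> star a}.
Proof. by elim/quotW=> t; rewrite [star _]Pol_starE !Pol_lift_pi. Qed.

HB.instance Definition _ := GRing.isZmodMorphism.Build Pol B lift Pol_lift_zmod.
HB.instance Definition _ :=
  GRing.isMonoidMorphism.Build Pol B lift Pol_lift_monoid.
HB.instance Definition _ := GRing.isScalable.Build C Pol B *:%R lift Pol_lift_scale.
HB.instance Definition _ := isStarMorphism.Build C Pol B lift Pol_lift_star.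

End Universal.

Theorem Pol_universal (B : starAlgType C) (q : 'I_n -> 'I_n -> B) :
  magic_unitary q ->
  exists f : starMorphism Pol B, (forall i j, f (Pol_gen i j) = q i j) /\
    forall g : starMorphism Pol B, (forall i j, g (Pol_gen i j) = q i j) -> g =1 f.
Proof.
move=> hq; exists (Pol_lift hq); split=> [i j|g gq]; first exact: Pol_lift_gen.
elim/quotW=> t; rewrite [RHS](Pol_lift_pi hq) pi_Pol_eval.
elim: t => /= [i j||| t <-|t <- u <-|t <- u <-|c t <-|t <-].
- exact: gq.
- exact: rmorph0.
- exact: rmorph1.
- exact: rmorphN.
- exact: rmorphD.
- exact: rmorphM.
- exact: linearZ.
- exact: starmorph_star.
Qed.

Definition delta_mat (i j : 'I_n) : C^o := (i == j)%:R.

Lemma delta_mat_magic : magic_unitary delta_mat.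
Proof.
suff -> : delta_mat = perm_mat C 1%g by exact: perm_mat_magic.
by apply/funext=> i; apply/funext=> j; rewrite /perm_mat perm1.
Qed.

Definition counit : starMorphism Pol C^o := Pol_lift delta_mat_magic.

Definition perm_char (s : 'S_n) : starMorphism Pol C^o :=
  Pol_lift (perm_mat_magic C s).

End PolAlgebra.

Section SubQuot.
Variables (K : fieldType) (V : lmodType K) (S : submodClosed V).

(* [submodClosed] does not inherit from [zmodClosed], which [Quotient] expects. *)
Definition submod_pred : {pred V} := S.
HB.instance Definition _ := GRing.isSubmodClosed.Build K V submod_pred
  (GRing.submod_closed_semi (submodClosedP S)).

Definition subspace := {x : V | submod_pred x}.
HB.instance Definition _ := SubChoice.on subspace.
HB.instance Definition _ := [SubChoice_isSubLmodule of subspace by <:].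

Definition quotspace := @Quotient.quot V submod_pred.
HB.instance Definition _ := GRing.Zmodule.on quotspace.
HB.instance Definition _ := ZmodQuotient.on quotspace.

Definition quot_scale (c : K) (x : quotspace) : quotspace :=
  \pi_quotspace (c *: repr x).

Lemma quot_scale_pi c (x : V) :
  quot_scale c (\pi_quotspace x) = \pi_quotspace (c *: x).
Proof.
apply/eqP; rewrite -Quotient.idealrBE -scalerBr; apply: rpredZ.
by have := @Quotient.idealrBE V submod_pred (repr (\pi_quotspace x)) x; rewrite reprK eqxx.
Qed.

Lemma quot_scaleA c d x : quot_scale c (quot_scale d x) = quot_scale (c * d) x.
Proof. by elim/quotW: x => x; rewrite (quot_scale_pi d) !quot_scale_pi scalerA. Qed.
Lemma quot_scale1 : left_id 1 quot_scale.
Proof. by elim/quotW=> x; rewrite quot_scale_pi scale1r. Qed.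
Lemma quot_scaleDr : right_distributive quot_scale +%R.
Proof.
move=> c; elim/quotW=> x; elim/quotW=> y.
by rewrite -raddfD (quot_scale_pi c x) (quot_scale_pi c y) quot_scale_pi scalerDr raddfD.
Qed.
Lemma quot_scaleDl x : {morph quot_scale^~ x : c d / c + d}.
Proof. by elim/quotW: x => x c d /=; rewrite (quot_scale_pi c) (quot_scale_pi d) quot_scale_pi scalerDl raddfD. Qed.

HB.instance Definition _ := GRing.Zmodule_isLmodule.Build K quotspace
  quot_scaleA quot_scale1 quot_scaleDr quot_scaleDl.

End SubQuot.

Definition lin_iso (K : fieldType) (U V : lmodType K) : Prop :=
  exists f : {linear U -> V}, bijective f.

(* Only the underlying action of the algebra by linear maps enters the
   definition of cocycles and coboundaries: a unital *-homomorphism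
   A -> B(h) induces such an action on the vector space h. *)
Record representation (C : numClosedFieldType) (A : algType C) (h : lmodType C) :=
  Representation {
    rep_op :> A -> {linear h -> h};
    rep_linear : forall (c : C) (a b : A) (v : h),
      rep_op (c *: a + b) v = c *: rep_op a v + rep_op b v;
    rep1 : forall v : h, rep_op 1 v = v;
    repM : forall (a b : A) (v : h), rep_op (a * b) v = rep_op a (rep_op b v)
  }.

Section Cohomology.
Variables (C : numClosedFieldType) (A : algType C) (h : lmodType C).
Variables (eps : {lrmorphism A -> C^o}) (rho : representation A h).

Definition is_cocycle (eta : A -> h) : Prop :=
  linear eta /\ forall a b, eta (a * b) = rho a (eta b) + (eps b : C) *: eta a.

Definition is_coboundary (eta : A -> h) : Prop :=
  exists v : h, forall a, eta a = rho a v - (eps a : C) *: v.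

Definition cocycle_pred : {pred (A -> h)} := fun eta => `[< is_cocycle eta >].
Definition coboundary_pred : {pred (A -> h)} := fun eta => `[< is_coboundary eta >].

Lemma cocycle_submod : submod_closed cocycle_pred.
Proof.
split=> [|c f g /asboolP[fl fc] /asboolP[gl gc]]; apply/asboolP; split.
- by move=> c a b; rewrite /= scaler0 addr0.
- by move=> a b; rewrite linear0 scaler0 addr0.
- move=> d a b; rewrite -[LHS]/(c *: f _ + g _) fl gl !scalerDr !scalerA.
  by rewrite addrACA [c * d]mulrC.
- move=> a b; rewrite -[LHS]/(c *: f _ + g _) fc gc.
  rewrite -[(c *: f + g) b]/(c *: f b + g b) -[(c *: f + g) a]/(c *: f a + g a).
  by rewrite linearP !scalerDr !scalerA addrACA [c * _]mulrC.
Qed.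

Lemma coboundary_submod : submod_closed coboundary_pred.
Proof.
split=> [|c f g /asboolP[v fv] /asboolP[w gw]]; apply/asboolP.
  by exists 0 => a; rewrite linear0 scaler0 subr0.
exists (c *: v + w) => a; rewrite -[LHS]/(c *: f a + g a) fv gw.
by rewrite linearP scalerBr scalerDr opprD addrACA !scalerA [c * _]mulrC.
Qed.

HB.instance Definition _ :=
  GRing.isSubmodClosed.Build C (A -> h) cocycle_pred
  (GRing.submod_closed_semi cocycle_submod).
HB.instance Definition _ :=
  GRing.isSubmodClosed.Build C (A -> h) coboundary_pred
  (GRing.submod_closed_semi coboundary_submod).

Definition Z1 := @subspace C (A -> h) cocycle_pred.
HB.instance Definition _ := GRing.Lmodule.on Z1.

Definition B1 := @subspace C (A -> h) coboundary_pred.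
HB.instance Definition _ := GRing.Lmodule.on B1.

Lemma coboundary_cocycle (eta : A -> h) : is_coboundary eta -> is_cocycle eta.
Proof.
case=> v etav; split=> [c a b|a b]; rewrite !etav.
- rewrite rep_linear (linearP eps) scalerDl scalerBr opprD addrACA.
  by rewrite [c *: eps a]/GRing.scale /= scalerA.
- rewrite repM rmorphM [rho a (_ - _)]linearB [rho a (_ *: _)]linearZ /=.
  by rewrite scalerBr scalerA [eps a * eps b]mulrC addrA addrNK.
Qed.

(* B_1(rho), seen inside the vector space Z_1(rho) in order to form Z_1 / B_1. *)
Definition B1_pred : {pred Z1} := fun z => coboundary_pred (val z).

Lemma B1_submod : submod_closed B1_pred.
Proof.
have [c0 cD] := coboundary_submod.
by split=> [|c f g ff gg]; rewrite /B1_pred /in_mem /= ?linear0 ?linearP //; apply: cD.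
Qed.

HB.instance Definition _ := GRing.isSubmodClosed.Build C Z1 B1_pred
  (GRing.submod_closed_semi B1_submod).

Definition H1 := @quotspace C Z1 B1_pred.
HB.instance Definition _ := GRing.Lmodule.on H1.

End Cohomology.

(* B(C) = C acts on C by multiplication. *)
Section ScalarRep.
Variables (C : numClosedFieldType) (A : starAlgType C) (chi : starMorphism A C^o).

Definition scalar_op (a : A) : C^o -> C^o := fun v => chi a * v.

Lemma scalar_op_linear a : linear (scalar_op a).
Proof. by move=> c v w; rewrite /scalar_op mulrDr -scalerAr. Qed.
HB.instance Definition _ a :=
  GRing.isLinear.Build C C^o C^o *:%R (scalar_op a) (scalar_op_linear a).

Let scalar_rep_linear (c : C) (a b : A) (v : C^o) :
  scalar_op (c *: a + b) v = c *: scalar_op a v + scalar_op b v.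
Proof. by rewrite /scalar_op linearP mulrDl -scalerAl. Qed.

Let scalar_rep1 (v : C^o) : scalar_op 1 v = v.
Proof. by rewrite /scalar_op rmorph1 mul1r. Qed.

Let scalar_repM (a b : A) (v : C^o) :
  scalar_op (a * b) v = scalar_op a (scalar_op b v).
Proof. by rewrite /scalar_op rmorphM mulrA. Qed.

Definition scalar_rep : representation A C^o :=
  @Representation C A C^o (fun a => scalar_op a)
    scalar_rep_linear scalar_rep1 scalar_repM.

End ScalarRep.

Definition perm_rep (C : numClosedFieldType) (n : nat) (s : 'S_n) :
    representation (Pol C n) C^o :=
  scalar_rep (perm_char C s).

Definition counit_rep (C : numClosedFieldType) (n : nat) :
    representation (Pol C n) C^o :=
  scalar_rep (counit C n).

(* [porbits s] contains a singleton orbit for each fixed point of [s]. *)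
Definition cyc (n : nat) (s : 'S_n) : nat := #|porbits s|.

Definition fixpts (n : nat) (s : 'S_n) : nat := #|[set i | s i == i]|.

(* Main.v *)
Require Import Defs.
From HB Require Import structures.
From mathcomp Require Import all_boot all_order all_algebra all_fingroup.
From mathcomp Require Import generic_quotient boolp functions.
From mathcomp Require Import reals complex ring.

(** A [perm_rep s]-cocycle [eta] is determined by its values on the generators
[p i j], and there the defining relations leave little freedom.  Idempotency of
[p i j] kills [eta (p i j)] unless exactly one of [i = j], [s i = j] holds; the
row relation [p i (s i) * p i i = 0] at a moved point [i] gives
[eta (p i (s i)) = - eta (p i i)], and the column relation
[p i (s i) * p (s i) (s i) = 0] gives
[eta (p (s i) (s i)) = - eta (p i (s i))].  Hence [eta] amounts to the function
[y i = eta (p i i)], which is constant on the cycles of [s] and vanishes at the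
fixed points ([cocycle_gen_diag], [cocycle_gen_eq0], [cocycle_diag_inj]).

Conversely every function [y] constant on the cycles comes from a cocycle whose
diagonal is [y] away from the fixed points ([cocycle_exists]).  A linear map
[eta] is a cocycle exactly when
[[
  a |-> [ rho a   eta a ]
        [   0     eps a ]
]]
is multiplicative, so it suffices to find 2 x 2 matrices of this shape
satisfying the magic relations.  They are not self-adjoint, hence do not define
a *-homomorphism into the 2 x 2 matrices; pairing every matrix with its adjoint,
inside the *-algebra of pairs whose involution swaps the components and takes
adjoints, repairs this ([exchange_magic]).

So [Z1] has one dimension for each cycle of length at least two.  The
coboundary of [v] has the diagonal value [- v] at every moved point, so the
coboundaries form the line of the diagonals that are constant on the moved
points.  Subtracting the value at one chosen moved point [j0] therefore identifies
[H1] with the functions on the nontrivial cycles other than that of [j0]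
([H1_perm_rep]).  For the identity permutation all points are fixed, so every
cocycle vanishes ([Z1_counit]). *)

Set Implicit Arguments.
Unset Strict Implicit.
Unset Printing Implicit Defensive.

Import GRing.Theory Num.Theory.
Local Open Scope ring_scope.
Local Open Scope quotient_scope.

(** * Induction on the algebra *)

Lemma star0 (C : numClosedFieldType) (A : starAlgType C) : star (0 : A) = 0.
Proof. by have := starZ 0 (0 : A); rewrite scaler0 rmorph0 scale0r. Qed.

Lemma star1 (C : numClosedFieldType) (A : starAlgType C) : star (1 : A) = 1.
Proof. by have := starM 1 (star (1 : A)); rewrite starK !mul1r starK => /esym. Qed.

(** The generators are self-adjoint, so they generate the algebra without the
help of the involution: pushing [star] to the leaves of a *-polynomial gives an
ordinary polynomial.  This is what makes the principle usable for cocycles,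
which need not be compatible with [star]. *)
Lemma Pol_alg_ind (C : numClosedFieldType) (n : nat) (K : Pol C n -> Prop) :
    (forall i j, K (Pol_gen C i j)) -> K 1 ->
    (forall (c : C) a b, K a -> K b -> K (c *: a + b)) ->
    (forall a b, K a -> K b -> K (a * b)) ->
  forall a, K a.
Proof.
move=> Kgen K1 Klin Kmul.
have K0 : K 0 by rewrite -(addNr 1) -scaleN1r; exact: Klin.
have Kadd a b : K a -> K b -> K (a + b) by rewrite -{2}[a]scale1r; exact: Klin.
have Kscale c a : K a -> K (c *: a) by rewrite -[c *: a]addr0 => Ka; exact: Klin.
elim/quotW=> t; rewrite pi_Pol_eval.
(* [TStar] exchanges the two halves of this strengthened claim. *)
suff [] : K (eval (@Pol_gen C n) t) /\ K (star (eval (@Pol_gen C n) t)) by [].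
elim: t => /= [i j|||t [IH IHs]|t [IHt IHts] u [IHu IHus]
  |t [IHt IHts] u [IHu IHus]|c t [IH IHs]|t [IH IHs]].
- by have [/(_ i j)[<- _]] := Pol_gen_magic C n.
- by rewrite star0.
- by rewrite star1.
- by rewrite -scaleN1r starZ; split; exact: Kscale.
- by rewrite starD; split; exact: Kadd.
- by rewrite starM; split; exact: Kmul.
- by rewrite starZ; split; exact: Kscale.
- by rewrite starK.
Qed.

Lemma perm_char_gen (C : numClosedFieldType) (n : nat) (s : 'S_n) i j :
  perm_char C s (Pol_gen C i j) = (s i == j)%:R.
Proof. exact: Pol_lift_gen. Qed.

Lemma counit_gen (C : numClosedFieldType) (n : nat) (i j : 'I_n) :
  counit C n (Pol_gen C i j) = (i == j)%:R.
Proof. exact: Pol_lift_gen. Qed.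

Lemma perm_char1 (C : numClosedFieldType) (n : nat) :
  perm_char C (1%g : 'S_n) =1 counit C n.
Proof.
apply: Pol_alg_ind => [i j||c a b IHa IHb|a b IHa IHb].
- by rewrite perm_char_gen counit_gen perm1.
- by rewrite !rmorph1.
- by rewrite !linearP /= IHa IHb.
- by rewrite !rmorphM /= IHa IHb.
Qed.

(** * Magic unitaries from matrices that are not self-adjoint *)

Definition conj_trmx (C : numClosedFieldType) (n : nat) (X : 'M[C]_n) : 'M[C]_n :=
  (map_mx Num.conj X)^T.

(** Carrier of the *-algebra whose involution is [exchange] below: a named copy
of the product algebra, so that the involution can be attached to it. *)
Definition exchange_mx (C : numClosedFieldType) (n : nat) : Type :=
  ('M[C]_n.+1 * 'M[C]_n.+1)%type.
HB.instance Definition _ C n := GRing.Algebra.on (exchange_mx C n).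

Definition exchange (C : numClosedFieldType) (n : nat) (x : exchange_mx C n) :
  exchange_mx C n := (conj_trmx x.2, conj_trmx x.1).

Lemma conj_trmxK (C : numClosedFieldType) (n : nat) : involutive (@conj_trmx C n).
Proof. by move=> X; apply/matrixP=> i j; rewrite !mxE conjCK. Qed.

Lemma conj_trmxD (C : numClosedFieldType) (n : nat) :
  {morph @conj_trmx C n : X Y / X + Y}.
Proof. by move=> X Y; rewrite /conj_trmx map_mxD linearD. Qed.

Lemma conj_trmxZ (C : numClosedFieldType) (n : nat) c (X : 'M[C]_n) :
  conj_trmx (c *: X) = c^* *: conj_trmx X.
Proof. by rewrite /conj_trmx map_mxZ linearZ. Qed.

Lemma conj_trmxM (C : numClosedFieldType) (n : nat) (X Y : 'M[C]_n.+1) :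
  conj_trmx (X * Y) = conj_trmx Y * conj_trmx X.
Proof. by rewrite /conj_trmx map_mxM trmx_mul. Qed.

Lemma exchangeK (C : numClosedFieldType) (n : nat) : involutive (@exchange C n).
Proof. by case=> X Y; rewrite /exchange /= !conj_trmxK. Qed.

Lemma exchangeD (C : numClosedFieldType) (n : nat) :
  {morph @exchange C n : x y / x + y}.
Proof. by move=> x y; rewrite /exchange /= !conj_trmxD. Qed.

Lemma exchangeZ (C : numClosedFieldType) (n : nat) c (x : exchange_mx C n) :
  exchange (c *: x) = c^* *: exchange x.
Proof. by rewrite /exchange /= !conj_trmxZ. Qed.

Lemma exchangeM (C : numClosedFieldType) (n : nat) (x y : exchange_mx C n) :
  exchange (x * y) = exchange y * exchange x.
Proof. by rewrite /exchange /= !conj_trmxM. Qed.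

HB.instance Definition _ (C : numClosedFieldType) (n : nat) :=
  hasStar.Build C (exchange_mx C n) (@exchangeK C n) (@exchangeD C n)
    (@exchangeZ C n) (@exchangeM C n).

(** Under [exchange] every pair [(X, conj_trmx X)] is self-adjoint, whatever [X]
is.  The product of two such pairs is [(X * Y, conj_trmx (Y * X))], and the
relations below are stable under reversing products, so matrices satisfying the
magic relations except self-adjointness still yield a magic unitary. *)
Lemma exchange_magic (C : numClosedFieldType) (m n : nat)
    (P : 'I_n -> 'I_n -> 'M[C]_m.+1) :
    (forall i j, P i j * P i j = P i j) ->
    (forall i j k, j != k -> P i j * P i k = 0) ->
    (forall i j k, j != k -> P j i * P k i = 0) ->
    (forall i, \sum_j P i j = 1) -> (forall i, \sum_j P j i = 1) ->
  magic_unitary (fun i j => (P i j, conj_trmx (P i j)) : exchange_mx C m).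
Proof.
move=> Pidem Prow Pcol Psumr Psumc.
have c0 : conj_trmx (0 : 'M[C]_m.+1) = 0.
  by apply/matrixP=> i j; rewrite !mxE rmorph0.
have c1 : conj_trmx (1 : 'M[C]_m.+1) = 1.
  by rewrite /conj_trmx map_mx1 trmx1.
have csum (F : 'I_n -> 'M[C]_m.+1) :
    \sum_j ((F j, conj_trmx (F j)) : exchange_mx C m)
      = (\sum_j F j, conj_trmx (\sum_j F j)).
  elim/big_rec2: _ => [|j y x _ ->]; first by rewrite c0.
  by rewrite conj_trmxD.
have cmul X Y : ((X, conj_trmx X) : exchange_mx C m) * (Y, conj_trmx Y)
    = (X * Y, conj_trmx (Y * X)) by rewrite conj_trmxM.
split=> [i j|i j k jk|i j k jk|i|i].
- split; last by rewrite expr2 cmul Pidem.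
  by rewrite -[RHS]/(exchange _) /exchange /= conj_trmxK.
- by rewrite cmul !Prow ?c0 // eq_sym.
- by rewrite cmul !Pcol ?c0 // eq_sym.
- by rewrite csum Psumr c1.
- by rewrite csum Psumc c1.
Qed.

(** * Cocycles with a prescribed diagonal *)

Definition triangular (C : numClosedFieldType) (a x b : C) : 'M[C]_2 :=
  \matrix_(i, j) if i == 0 then (if j == 0 then a else x)
                 else (if j == 0 then 0 else b).

Lemma triangularM (C : numClosedFieldType) (a x b a' x' b' : C) :
  triangular a x b * triangular a' x' b' =
  triangular (a * a') (a * x' + x * b') (b * b').
Proof.
apply/matrixP=> i j; rewrite !mxE !big_ord_recl big_ord0 !mxE /=.
by case: (i == 0); case: (j == 0); ring.
Qed.

Lemma triangular_sum (C : numClosedFieldType) (n : nat) (a x b : 'I_n -> C) :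
  \sum_j triangular (a j) (x j) (b j) =
  triangular (\sum_j a j) (\sum_j x j) (\sum_j b j).
Proof.
apply/matrixP=> i j; rewrite summxE !mxE.
rewrite (eq_bigr (fun k => if i == 0 then if j == 0 then a k else x k
  else if j == 0 then 0 else b k)) => [|k _]; last by rewrite mxE.
by case: (i == 0); case: (j == 0); rewrite ?big1_eq.
Qed.

Lemma triangular1 (C : numClosedFieldType) : triangular 1 0 1 = 1 :> 'M[C]_2.
Proof. by apply/matrixP=> -[[|[|//]] ?] [[|[|//]] ?]; rewrite !mxE. Qed.

Lemma triangular0 (C : numClosedFieldType) : triangular 0 0 0 = 0 :> 'M[C]_2.
Proof. by apply/matrixP=> i j; rewrite !mxE; case: ifP; case: ifP. Qed.

(** In row [i] the corner entry is that of the coboundary of [- y i], that is,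
this is the diagonal matrix of [(s i == j)] and [(i == j)] conjugated by a
unipotent matrix depending on [i] only.  The relations within a row thus hold
for free, and only those within a column constrain [y]. *)
Definition cocycle_mx (C : numClosedFieldType) (n : nat) (s : 'S_n)
    (y : 'I_n -> C) (i j : 'I_n) : 'M[C]_2 :=
  triangular (s i == j)%:R (((i == j)%:R - (s i == j)%:R) * y i) (i == j)%:R.

Lemma cocycle_mx_magic (C : numClosedFieldType) (n : nat) (s : 'S_n)
    (y : 'I_n -> C) : (forall i, y (s i) = y i) ->
  magic_unitary (fun i j =>
    (cocycle_mx s y i j, conj_trmx (cocycle_mx s y i j)) : exchange_mx C 1).
Proof.
move=> ys.
have [_ r_row r_col r_sumr r_sumc] := perm_mat_magic C s.
have [_ e_row e_col e_sumr e_sumc] := delta_mat_magic C n.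
rewrite /perm_mat /delta_mat in r_row r_col r_sumr r_sumc
  e_row e_col e_sumr e_sumc.
(* The corner of a product of two entries: up to the orthogonality relations
   only the last summand survives; it vanishes within a row as [z = z'], and
   within a column because [r * e' != 0] forces [z'] and [z] to be the values
   of [y] at a point and at its preimage. *)
have corner (r r' e e' z z' : C) : r * ((e' - r') * z') + (e - r) * z * e' =
    e * e' * z - r * r' * z' + r * e' * (z' - z) by ring.
apply: exchange_magic => [i j|i j k jk|i j k jk|i|i]; rewrite /cocycle_mx.
- rewrite triangularM; congr triangular.
  + by rewrite -natrM mulnb andbb.
  + by case: (s i == j); case: (i == j) => /=; ring.
  + by rewrite -natrM mulnb andbb.
- rewrite triangularM -triangular0; congr triangular; first exact: r_row.
    by rewrite corner (r_row i j k jk) (e_row i j k jk); ring.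
  exact: e_row.
- rewrite triangularM -triangular0; congr triangular; first exact: r_col.
    rewrite corner (r_col i j k jk) (e_col i j k jk).
    case: (k =P i) => [->|_] /=; last by ring.
    by case: (s j =P i) => [<-|_] /=; rewrite ?ys; ring.
  exact: e_col.
- rewrite triangular_sum -mulr_suml sumrB r_sumr e_sumr subrr mul0r.
  exact: triangular1.
- rewrite triangular_sum r_sumc e_sumc -triangular1; congr triangular.
  rewrite (eq_bigr (fun j => (j == i)%:R * y j - (s j == i)%:R * y j));
    last by move=> j _; rewrite mulrBl.
  rewrite sumrB [X in _ - X](reindex_inj (@perm_inj _ (s^-1)%g)) /=.
  rewrite -sumrB big1 // => j _; rewrite permKV -{2}[j](permKV s) ys.
  by rewrite subrr.
Qed.

(** * The diagonal of a cocycle *)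

Lemma cocycle_eq0 (C : numClosedFieldType) (n : nat) (h : lmodType C)
    (rho : representation (Pol C n) h) (eta : Pol C n -> h) :
    is_cocycle (counit C n) rho eta ->
    (forall i j, eta (Pol_gen C i j) = 0) ->
  forall a, eta a = 0.
Proof.
case=> eta_lin etaM eta_gen; apply: Pol_alg_ind => //.
- have := etaM 1 1; rewrite mulr1 rep1 rmorph1 scale1r.
  by move/eqP; rewrite -subr_eq subrr eq_sym => /eqP.
- by move=> c a b a0 b0; rewrite eta_lin a0 b0 scaler0 addr0.
- by move=> a b a0 b0; rewrite etaM a0 b0 linear0 scaler0 addr0.
Qed.

Lemma cocycle0 (C : numClosedFieldType) (n : nat) (s : 'S_n)
    (eta : Pol C n -> C^o) :
  is_cocycle (counit C n) (perm_rep C s) eta -> eta 0 = 0.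
Proof.
by move=> etaP; have := etaP.1 (-1) 0 0; rewrite scaler0 addr0 scaleN1r addNr.
Qed.

Lemma cocycle_gen_mul (C : numClosedFieldType) (n : nat) (s : 'S_n)
    (eta : Pol C n -> C^o) i j k l :
  is_cocycle (counit C n) (perm_rep C s) eta ->
  eta (Pol_gen C i j * Pol_gen C k l) =
  (s i == j)%:R * eta (Pol_gen C k l) + (k == l)%:R * eta (Pol_gen C i j).
Proof. by move=> etaP; rewrite etaP.2 -perm_char_gen -counit_gen. Qed.

(** Applying [eta] to [p = p ^+ 2] multiplies [eta p] by the sum of the two
characters at [p], which is 0 or 2 when they agree. *)
Lemma cocycle_gen_eq0 (C : numClosedFieldType) (n : nat) (s : 'S_n)
    (eta : Pol C n -> C^o) i j :
  is_cocycle (counit C n) (perm_rep C s) eta ->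
  (s i == j) = (i == j) -> eta (Pol_gen C i j) = 0.
Proof.
move=> etaP eq_ij.
have [/(_ i j)[_ /(congr1 eta) p_idem] _ _ _ _] := Pol_gen_magic C n.
move: p_idem; rewrite expr2 (cocycle_gen_mul _ _ _ _ etaP) eq_ij.
case: (i == j); last by rewrite !mul0r addr0.
by rewrite !mul1r => /eqP; rewrite -subr_eq subrr eq_sym => /eqP.
Qed.

Lemma cocycle_gen_image (C : numClosedFieldType) (n : nat) (s : 'S_n)
    (eta : Pol C n -> C^o) i :
  is_cocycle (counit C n) (perm_rep C s) eta ->
  s i != i -> eta (Pol_gen C i (s i)) = - eta (Pol_gen C i i).
Proof.
move=> etaP si; have [_ /(_ i _ _ si)/(congr1 eta) + _ _ _] := Pol_gen_magic C n.
rewrite (cocycle_gen_mul _ _ _ _ etaP) (cocycle0 etaP) !eqxx !mul1r.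
by move/eqP; rewrite addrC addr_eq0 => /eqP.
Qed.

(** The column relation [p i (s i) * p (s i) (s i) = 0] links the diagonal
values at [i] and [s i] through [cocycle_gen_image]. *)
Lemma cocycle_gen_diag (C : numClosedFieldType) (n : nat) (s : 'S_n)
    (eta : Pol C n -> C^o) i :
  is_cocycle (counit C n) (perm_rep C s) eta ->
  eta (Pol_gen C (s i) (s i)) = eta (Pol_gen C i i).
Proof.
move=> etaP; have [->//|si] := eqVneq (s i) i.
have isi : i != s i by rewrite eq_sym.
have [_ _ /(_ (s i) _ _ isi)/(congr1 eta) + _ _] := Pol_gen_magic C n.
rewrite (cocycle_gen_mul _ _ _ _ etaP) (cocycle0 etaP) !eqxx !mul1r.
rewrite (cocycle_gen_image etaP) //.
by move/eqP; rewrite subr_eq0 => /eqP.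
Qed.

Lemma cocycle_diag_eq0 (C : numClosedFieldType) (n : nat) (s : 'S_n)
    (eta : Pol C n -> C^o) :
  is_cocycle (counit C n) (perm_rep C s) eta ->
  (forall i, eta (Pol_gen C i i) = 0) -> forall a, eta a = 0.
Proof.
move=> etaP diag0; apply: (cocycle_eq0 etaP) => i j.
have [<-//|ij] := eqVneq i j.
have [<-|sij] := eqVneq (s i) j; last first.
  by apply: (cocycle_gen_eq0 etaP); rewrite (negPf ij) (negPf sij).
have [->|si] := eqVneq (s i) i; first exact: diag0.
by rewrite (cocycle_gen_image etaP) // diag0 oppr0.
Qed.

Lemma cocycle_diag_inj (C : numClosedFieldType) (n : nat) (s : 'S_n)
    (eta theta : Pol C n -> C^o) :
  is_cocycle (counit C n) (perm_rep C s) eta ->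
  is_cocycle (counit C n) (perm_rep C s) theta ->
  (forall i, eta (Pol_gen C i i) = theta (Pol_gen C i i)) -> eta =1 theta.
Proof.
move=> etaP thetaP diag a; apply/eqP; rewrite -subr_eq0; apply/eqP.
have /asboolP dP := (cocycle_submod (counit C n) (perm_rep C s)).2 (-1) theta eta
  (asboolT thetaP) (asboolT etaP).
have dE b : (-1 *: theta + eta) b = eta b - theta b.
  by rewrite scaleN1r addrC.
by rewrite -dE; apply: (cocycle_diag_eq0 dP) => i; rewrite dE diag subrr.
Qed.

(** The cocycle is the corner of the homomorphism given by [cocycle_mx]; the
cocycle identity is the multiplication rule of triangular matrices. *)
Lemma cocycle_exists (C : numClosedFieldType) (n : nat) (s : 'S_n)
    (y : 'I_n -> C) : (forall i, y (s i) = y i) ->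
  exists2 eta, is_cocycle (counit C n) (perm_rep C s) eta
    & forall i j, eta (Pol_gen C i j) = ((i == j)%:R - (s i == j)%:R) * y i.
Proof.
move=> ys.
pose L : starMorphism (Pol C n) (exchange_mx C 1) :=
  Pol_lift (cocycle_mx_magic ys).
have Lgen i j : (L (Pol_gen C i j)).1 = cocycle_mx s y i j.
  by rewrite [L _]Pol_lift_gen.
have Ltri a : exists x, (L a).1 = triangular (perm_char C s a) x (counit C n a).
  move: a; apply: Pol_alg_ind => [i j||c a b [x ax] [z bz]|a b [x ax] [z bz]].
  - by exists (((i == j)%:R - (s i == j)%:R) * y i);
      rewrite Lgen perm_char_gen counit_gen.
  - by exists 0; rewrite !rmorph1; exact: esym (triangular1 C).
  - exists (c * x + z); rewrite !linearP /= ax bz.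
    by apply/matrixP=> i j; rewrite !mxE; case: (i == 0); case: (j == 0);
      rewrite ?mulr0 ?addr0.
  - exists (perm_char C s a * z + x * counit C n b).
    by rewrite !rmorphM /= ax bz triangularM.
exists (fun a => (L a).1 0 1); last by move=> i j; rewrite Lgen mxE.
split=> [c a b|a b]; first by rewrite linearP /= !mxE.
have [[x ax] [z bz]] := (Ltri a, Ltri b).
by rewrite rmorphM /= ax bz triangularM !mxE /= [x * _]mulrC.
Qed.

(** * Isomorphisms of quotient spaces *)

Lemma quotspace_iso (K : fieldType) (V : lmodType K) (S : submodClosed V)
    (W : lmodType K) (f : V -> W) :
    linear f -> (forall x, (x \in S) = (f x == 0)) ->
    (forall w, exists x, f x = w) ->
  lin_iso (quotspace S) W.
Proof.
move=> f_lin f_ker f_surj.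
pose g := HB.pack_for {linear V -> W} f (GRing.isLinear.Build K V W *:%R f f_lin).
pose F (q : quotspace S) : W := g (repr q).
have piE x y : (\pi_(quotspace S) x == \pi_(quotspace S) y) = (f x == f y).
  rewrite -Quotient.idealrBE -[LHS]/(x - y \in S) f_ker.
  by rewrite -[f _]/(g _) linearB subr_eq0.
have Fpi x : F (\pi_(quotspace S) x) = f x by apply/eqP; rewrite -piE reprK.
have F_lin : linear F.
  move=> c; elim/quotW=> x; elim/quotW=> y.
  by rewrite [c *: _]quot_scale_pi -raddfD !Fpi f_lin.
exists (HB.pack_for {linear quotspace S -> W} F
  (GRing.isLinear.Build K (quotspace S) W *:%R F F_lin)).
have [h hK] := choice f_surj.
exists (\pi_(quotspace S) \o h) => [|w] /=; last by rewrite Fpi hK.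
by elim/quotW=> x /=; apply/eqP; rewrite piE hK Fpi.
Qed.

Lemma lin_iso_trivial (K : fieldType) (U V : lmodType K) :
  (forall u : U, u = 0) -> (forall v : V, v = 0) -> lin_iso U V.
Proof.
move=> U0 V0; exists (\0 : {linear U -> V}).
by exists (fun=> 0) => [u|v]; rewrite ?(U0 u) ?(V0 v).
Qed.

(** * Counting and separating the nontrivial cycles *)

(** A basis of the cohomology: fixed points carry no cocycle, and the cycle of
the moved point [j0] is given up for the line of coboundaries. *)
Definition other_orbits (n : nat) (s : 'S_n) (j0 : 'I_n) : {set {set 'I_n}} :=
  (porbits s :\: porbit s @: [set i | s i == i]) :\ porbit s j0.

Lemma porbit_fix (n : nat) (s : 'S_n) (i : 'I_n) :
  s i = i -> porbit s i = [set i].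
Proof.
move=> si; apply/setP=> j; rewrite inE; apply/porbitP/eqP=> [[k ->]|->].
  by rewrite permX iter_fix.
by exists 0%N; rewrite perm1.
Qed.

(** As [j0] is moved there is at least one nontrivial cycle, so neither truncated
subtraction on the right loses anything. *)
Lemma card_other_orbits (n : nat) (s : 'S_n) (j0 : 'I_n) :
  s j0 != j0 -> #|other_orbits s j0| = (cyc s - fixpts s - 1)%N.
Proof.
move=> sj0; rewrite /other_orbits /cyc /fixpts.
have fix_inj : {in [set i | s i == i] &, injective (porbit s)}.
  move=> i k; rewrite !inE => /eqP si /eqP sk /eqP.
  by rewrite !porbit_fix // => /eqP/set1_inj.
have moved : porbit s j0 \in porbits s :\: porbit s @: [set i | s i == i].
  rewrite inE [X in _ && X]imset_f // andbT; apply/imsetP=> -[k].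
  rewrite inE => /eqP sk.
  move=> /setP/(_ j0); rewrite porbit_id porbit_fix // inE => /esym/eqP j0k.
  by rewrite j0k sk eqxx in sj0.
rewrite cardsDS ?sub1set // cards1 cardsDS ?(card_in_imset fix_inj) //.
by apply/subsetP=> _ /imsetP[i _ ->]; apply: imset_f.
Qed.

Lemma porbit_invariant (T : Type) (n : nat) (s : 'S_n) (y : 'I_n -> T) :
  (forall i, y (s i) = y i) ->
  forall i j, porbit s i = porbit s j -> y i = y j.
Proof.
move=> ys i j /eqP; rewrite eq_porbit_mem => /porbitP[k ->].
by rewrite permX; elim: k => //= k IH; rewrite ys.
Qed.

(** * The cohomology groups *)

(** With [j0] a moved point and [r k] a representative of the [k]-th nontrivial
cycle not containing [j0], the map [z |-> y (r k) - y j0], where [y] is the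
diagonal of [z], is onto by [cocycle_exists] and vanishes exactly when [y] is
constant on the moved points, that is, when [z] is the coboundary of
[- y j0]. *)
Lemma H1_perm_rep (C : numClosedFieldType) (n : nat) (s : 'S_n) :
  s <> 1%g ->
  lin_iso (H1 (counit C n) (perm_rep C s)) 'rV[C]_(cyc s - fixpts s - 1).
Proof.
move=> /eqP s1.
have [j0 sj0] : exists j0, s j0 != j0.
  apply/existsP; apply: contraR s1; rewrite negb_exists => /forallP s_id.
  by apply/eqP/permP=> i; rewrite perm1; apply/eqP; have := s_id i; rewrite negbK.
rewrite -(card_other_orbits sj0); set O := other_orbits s j0.
have rP (k : 'I_#|O|) : exists i, porbit s i = enum_val k.
  by have := enum_valP k; rewrite !inE => /and3P[_ _ /imsetP[i _ ->]]; exists i.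
have [r rE] := choice rP.
have sr k : s (r k) != r k.
  have := enum_valP k; rewrite -rE !inE => /and3P[_ + _].
  by apply: contra => srk; apply: imset_f; rewrite inE.
pose f (z : Z1 (counit C n) (perm_rep C s)) : 'rV[C]_#|O| :=
  \row_k (val z (Pol_gen C (r k) (r k)) - val z (Pol_gen C j0 j0)).
apply: (quotspace_iso (f := f)) => [c z w|z|w].
- apply/rowP=> k; rewrite !mxE linearP /=.
  by rewrite mulrBr opprD addrACA.
- have zP : is_cocycle (counit C n) (perm_rep C s) (val z).
    by apply/asboolP; exact: (valP z).
  rewrite -[LHS]/(`[< is_coboundary (counit C n) (perm_rep C s) (val z) >]).
  apply/asboolP/eqP => [[v zE]|/rowP fz0].
    apply/rowP=> k; rewrite !mxE !zE.
    rewrite /perm_rep /= /scalar_op !perm_char_gen !counit_gen !eqxx.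
    by rewrite (negPf sj0) (negPf (sr k)) subrr.
  pose y i := val z (Pol_gen C i i).
  have y_moved i : s i != i -> y i = y j0.
    move=> si; have yO := porbit_invariant (y := y) (fun k => cocycle_gen_diag k zP).
    have [|iO] := eqVneq (porbit s i) (porbit s j0); first exact: yO.
    have {iO} : porbit s i \in O.
      rewrite !inE iO andTb [X in _ && X]imset_f // andbT.
      apply/imsetP=> -[k]; rewrite inE.
      move=> /eqP sk ik; have := porbit_id s i.
      by rewrite ik porbit_fix // inE => /eqP ik'; rewrite ik' sk eqxx in si.
    move=> iO; have := fz0 (enum_rank_in iO (porbit s i)); rewrite !mxE.
    move/eqP; rewrite subr_eq0 => /eqP; apply: etrans; apply: yO.
    by rewrite rE enum_rankK_in.
  pose b a : C^o := perm_rep C s a (- y j0) - (counit C n a : C) *: (- y j0).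
  have bP : is_cocycle (counit C n) (perm_rep C s) b.
    by apply: coboundary_cocycle; exists (- y j0).
  exists (- y j0); apply: (cocycle_diag_inj zP bP) => i.
  rewrite /b /perm_rep /= /scalar_op perm_char_gen counit_gen eqxx.
  have [si|si] := eqVneq (s i) i.
    by rewrite (cocycle_gen_eq0 zP) ?si // mul1r scale1r subrr.
  by rewrite -[val z _]/(y i) y_moved // mul0r sub0r scale1r opprK.
- (* The sum has one term on the cycles in [O] and none elsewhere, so [y]
     vanishes on the cycle of [j0]. *)
  pose y i := \sum_(k | enum_val k == porbit s i) w 0 k.
  have ys i : y (s i) = y i.
    by rewrite /y; have := porbit_perm s 1 i; rewrite expg1 => ->.
  have [eta etaP etaE] := cocycle_exists ys.
  exists (exist _ eta (asboolT etaP)); apply/rowP=> k; rewrite !mxE /= !etaE.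
  rewrite !eqxx (negPf sj0) (negPf (sr k)) subr0 !mul1r.
  rewrite /y (big_pred1 k) => [|l]; last by rewrite rE (inj_eq enum_val_inj).
  rewrite big_pred0 ?subr0 // => l; apply: contraTF (enum_valP l) => /eqP ->.
  by rewrite !inE eqxx.
Qed.

(** For the identity permutation the two characters agree on every generator, so
idempotency alone kills the cocycle. *)
Lemma Z1_counit (C : numClosedFieldType) (n : nat)
    (z : Z1 (counit C n) (counit_rep C n)) : z = 0.
Proof.
have zP : is_cocycle (counit C n) (counit_rep C n) (val z).
  by apply/asboolP; exact: (valP z).
have zP1 : is_cocycle (counit C n) (perm_rep C 1%g) (val z).
  split=> [|a b]; first exact: zP.1.
  by rewrite zP.2 /= /scalar_op perm_char1.
apply: val_inj; apply/funext=> a; apply: (cocycle_diag_eq0 zP1) => i.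
by apply: (cocycle_gen_eq0 zP1); rewrite perm1.
Qed.

Theorem proposition9p1 (R : realType) (n : nat) (hn : (0 < n)%N) (s : 'S_n) :
  (s <> 1%g ->
     lin_iso (H1 (counit R[i] n) (perm_rep R[i] s))
             'rV[R[i]]_(cyc s - fixpts s - 1)) /\
  (s = 1%g ->
     [/\ perm_char R[i] s =1 counit R[i] n,
         lin_iso (B1 (counit R[i] n) (counit_rep R[i] n))
                 (Z1 (counit R[i] n) (counit_rep R[i] n)),
         lin_iso (Z1 (counit R[i] n) (counit_rep R[i] n))
                 (H1 (counit R[i] n) (counit_rep R[i] n))
       & lin_iso (H1 (counit R[i] n) (counit_rep R[i] n))
                 'rV[R[i]]_0]).
Proof.
split=> [|->]; first exact: H1_perm_rep.
have Z0 := @Z1_counit R[i] n.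
have B0 (b : B1 (counit R[i] n) (counit_rep R[i] n)) : b = 0.
  have /asboolP/coboundary_cocycle bP := valP b.
  by apply: val_inj; exact: (congr1 val (Z0 (exist _ (val b) (asboolT bP)))).
have H0 (x : H1 (counit R[i] n) (counit_rep R[i] n)) : x = 0.
  by elim/quotW: x => z; rewrite (Z0 z) raddf0.
split; first exact: perm_char1.
- exact: lin_iso_trivial.
- exact: lin_iso_trivial.
- by apply: lin_iso_trivial => // v; apply/rowP=> -[].
Qed.
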